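(* Let $0 \leq d \leq n$ and $s \geq 1$ be integers and let $\mathcal F_1,\dots,\mathcal F_s \subset 2^{[n]}$ be $d$-cross-dependent. Then \[ \sum_{1 \leq i \leq s} \|\mathcal F_i\|_n \leq (n+1)s - (d+1). \]
   Context: $[n]=\{1,\dots,n\}$. For $\mathcal F \subset 2^{[n]}$ the binomial norm is $\|\mathcal F\|_n = \sum_{F \in \mathcal F} 1\big/\binom{n}{|F|}$. Families $\mathcal F_1,\dots,\mathcal F_s \subset 2^{[n]}$ are $d$-cross-dependent if there is no choice of pairwise disjoint $F_1 \in \mathcal F_1,\dots,F_s \in \mathcal F_s$ with $|F_1 \cup \dots \cup F_s| \leq d$. *)

(* Defs.v *)
From mathcomp Require Import all_boot all_order all_algebra.

Set Implicit Arguments.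
Unset Strict Implicit.
Unset Printing Implicit Defensive.

Import GRing.Theory Num.Theory.
Local Open Scope ring_scope.

(* The ground set [n] = {1, ..., n} is encoded as 'I_n = {0, ..., n-1}. *)

Definition binomial_norm (n : nat) (F : {set {set 'I_n}}) : rat :=
  \sum_(A in F) ('C(n, #|A|)%:R)^-1.

(* Disjointness is required for distinct indices only, so the chosen sets may
   coincide when they are empty. *)
Definition cross_dependent (n s d : nat) (F : 'I_s -> {set {set 'I_n}}) : Prop :=
  ~ exists A : 'I_s -> {set 'I_n},
      [/\ forall i, A i \in F i,
          forall i j, i != j -> [disjoint A i & A j]
        & (#|\bigcup_i A i| <= d)%N].

(* Main.v *)
(** Merging is the key: if [A] and [B] are two families and [djoin A B] is the
    family of all unions of disjoint members of [A] and [B], then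
    [||A|| + ||B|| <= (n + 1) + ||djoin A B||].
    Merging all of [F_1, ..., F_s] leaves a single family without sets of size
    at most [d], whose norm is at most [n - d].

    The norm of a family is the average number of its members in a uniformly
    random maximal chain, i.e. among the initial segments of a random ordering.
    Given an ordering, let [a] be the size of its first initial segment that is
    in [A]. Reversing the ordering above [a] gives a new ordering with the same
    [a], hence a bijection, and its initial segment of size [a + b] is the union
    of the initial segment of size [a] and the final segment of size [b] of the
    original one. So every final segment of size at most [n - a] in [B] yields a
    member of [djoin A B] in the new chain, and at most [n + 1 - a] initial
    segments are in [A]. *)

Require Import Defs.
From mathcomp Require Import all_boot all_order all_algebra all_fingroup.
From mathcomp Require Import zify lra.

Set Implicit Arguments.
Unset Strict Implicit.
Unset Printing Implicit Defensive.

Import GRing.Theory Num.Theory.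
Local Open Scope ring_scope.

(** * Orderings, their initial segments, and the norm as an average over chains *)

(* A permutation [p] is read as an ordering: [p x] is the position of [x]. *)
Definition initial n (p : {perm 'I_n}) (k : nat) : {set 'I_n} :=
  [set x | (p x < k)%N].

Definition chain_count n (p : {perm 'I_n}) (F : {set {set 'I_n}}) : nat :=
  (\sum_(k < n.+1) (initial p k \in F))%N.

Lemma card_initial n (p : {perm 'I_n}) k : (k <= n)%N -> #|initial p k| = k.
Proof.
move=> le_kn; have -> : initial p k = p @^-1: [set i : 'I_n | (i < k)%N].
  by apply/setP=> x; rewrite !inE.
rewrite card_preimset; last exact: perm_inj.
rewrite -sum1dep_card (big_ord_narrow le_kn).
by rewrite sum1_card card_ord.
Qed.

Lemma exists_initial n (A : {set 'I_n}) :
  exists p : {perm 'I_n}, initial p #|A| = A.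
Proof.
pose s := enum A ++ enum (~: A).
have mem_s x : x \in s by rewrite mem_cat !mem_enum inE orbN.
have size_s : size s = n by rewrite size_cat -!cardE cardsC card_ord.
have lt_s x : (index x s < n)%N by rewrite -[X in (_ < X)%N]size_s index_mem.
have inj_s : injective (fun x => Ordinal (lt_s x)).
  move=> x y [] eq_xy.
  by rewrite -(nth_index x (mem_s x)) eq_xy (nth_index x (mem_s y)).
exists (perm inj_s); apply/setP=> x; rewrite inE permE /= index_cat mem_enum.
by case: ifP => xA; rewrite cardE ?index_mem ?mem_enum // ltnNge leq_addr.
Qed.

(** All sets of size [k] begin equally many orderings: if [q] begins with [B], then [p] begins with
    the first [k] points exactly when [q * p] begins with [B]. Each of the [n]! orderings begins
    with one of the 'C(n, k) sets. *)
Lemma card_perm_initial n (A : {set 'I_n}) :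
  (#|[set p : {perm 'I_n} | initial p #|A| == A]| * 'C(n, #|A|) = n`!)%N.
Proof.
set k := #|A|.
have le_kn : (k <= n)%N by rewrite -[n in leqRHS]card_ord max_card.
pose N (B : {set 'I_n}) := #|[set p : {perm 'I_n} | initial p k == B]|.
have N_const (B : {set 'I_n}) : #|B| = k -> N B = N (initial 1%g k).
  move=> cardB; have [q qB] := exists_initial B; rewrite cardB in qB.
  rewrite /N -(card_preimset _ (mulgI q)); apply: eq_card => p; rewrite !inE.
  rewrite -{1}qB; apply/eqP/eqP => /setP eq_p; apply/setP => x.
    by have := eq_p (q^-1%g x); rewrite !inE permM permKV perm1.
  by have := eq_p (q x); rewrite !inE permM perm1.
rewrite -/(N A) N_const //.
transitivity (\sum_(B : {set 'I_n} | #|B| == k) N B)%N.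
  rewrite (eq_bigr (fun _ => N (initial 1%g k))); last by move=> B /eqP/N_const.
  rewrite (eq_bigl (mem [set B : {set 'I_n} | #|B| == k])) => [|B]; last first.
    by rewrite !inE.
  by rewrite sum_nat_const card_draws card_ord mulnC.
rewrite -card_Sn -sum1_card.
rewrite (partition_big (fun p => initial p k)
  (fun B : {set 'I_n} => #|B| == k)) /=.
  by apply: eq_bigr => B _; rewrite /N -sum1dep_card.
by move=> p _; rewrite card_initial.
Qed.

(** Double counting of pairs of an ordering and a member of [F] that is one of its initial
    segments. *)
Lemma binomial_norm_chain n (F : {set {set 'I_n}}) :
  binomial_norm F * n`!%:R = (\sum_(p : {perm 'I_n}) chain_count p F)%:R.
Proof.
have -> : (\sum_(p : {perm 'I_n}) chain_count p F =
    \sum_(A in F) #|[set p : {perm 'I_n} | initial p #|A| == A]|)%N.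
  under [RHS]eq_bigr => A _ do
    rewrite -sum1dep_card big_mkcond /=; rewrite [RHS]exchange_big /=.
  apply: eq_bigr => p _.
  transitivity (\sum_(k < n.+1) \sum_(A in F) (initial p k == A))%N.
    apply: eq_bigr => k _; case: (boolP (_ \in F)) => kF.
      rewrite (bigD1 (initial p k)) //= eqxx big1 // => A /andP[_].
      by rewrite eq_sym => /negPf->.
    rewrite big1 // => A AF; case: eqP => // eqA; by rewrite eqA AF in kF.
  rewrite exchange_big; apply: eq_bigr => A _ /=.
  have lt_An : (#|A| < n.+1)%N by rewrite ltnS -[n in leqRHS]card_ord max_card.
  rewrite (bigD1 (Ordinal lt_An)) //= big1 ?addn0; first by case: eqP.
  move=> k neq_k; case: eqP => // eqA; case/eqP: neq_k; apply: val_inj.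
  by rewrite /= -eqA card_initial // -ltnS.
rewrite natr_sum /binomial_norm mulr_suml; apply: eq_bigr => A _.
rewrite -(card_perm_initial A) natrM mulrCA mulVf ?mulr1 //.
by rewrite pnatr_eq0 -lt0n bin_gt0 -[n in leqRHS]card_ord max_card.
Qed.

(** * Reversing an ordering above a position *)

(** The default [i] of [insubd] is never taken: the reflected position stays between [a] and
    [n - 1]. *)
Definition reverse_above n (a : nat) (i : 'I_n) : 'I_n :=
  if (i < a)%N then i else insubd i (a + n - i.+1)%N.

Lemma reverse_aboveE n a (i : 'I_n) :
  reverse_above a i = (if i < a then i : nat else a + n - i.+1)%N :> nat.
Proof.
rewrite /reverse_above; case: ifP => // /negbT; rewrite -leqNgt => le_ai.
by rewrite val_insubd; have := ltn_ord i; case: ifP => //; lia.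
Qed.

Lemma reverse_aboveK n a : involutive (@reverse_above n a).
Proof.
move=> i; apply/val_inj; rewrite /= !reverse_aboveE.
by have := ltn_ord i; do 2 (case: ifP); lia.
Qed.

(* [initial (p * reverse_perm n 0) b] is the final segment of size [b] of [p]. *)
Definition reverse_perm n a : {perm 'I_n} :=
  perm (can_inj (@reverse_aboveK n a)).

Lemma initial_reverse_low n (p : {perm 'I_n}) a k : (k <= a)%N ->
  initial (p * reverse_perm n a)%g k = initial p k.
Proof.
move=> le_ka; apply/setP=> x; rewrite !inE permM permE reverse_aboveE.
by have := ltn_ord (p x); case: ifP; lia.
Qed.

Lemma initial_reverse_high n (p : {perm 'I_n}) a b : (a + b <= n)%N ->
  initial (p * reverse_perm n a)%g (a + b) =
    initial p a :|: initial (p * reverse_perm n 0)%g b.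
Proof.
move=> le_abn; apply/setP=> x; rewrite !inE !permM !permE !reverse_aboveE.
by have := ltn_ord (p x); rewrite ltn0; case: ifP; lia.
Qed.

Lemma disjoint_initial_final n (p : {perm 'I_n}) a b : (a + b <= n)%N ->
  [disjoint initial p a & initial (p * reverse_perm n 0)%g b].
Proof.
move=> le_abn; rewrite -setI_eq0; apply/eqP/setP=> x.
rewrite !inE permM permE reverse_aboveE ltn0.
by have := ltn_ord (p x); lia.
Qed.

(** * Merging two families *)

Definition djoin n (A B : {set {set 'I_n}}) : {set {set 'I_n}} :=
  [set X :|: Y | X in A, Y in B & [disjoint X & Y]].

(* The value is [n.+1] when no initial segment of [p] is in [A]. *)
Definition first_initial n (A : {set {set 'I_n}}) (p : {perm 'I_n}) : nat :=
  find (fun k => initial p k \in A) (iota 0 n.+1).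

Definition reflect_above n (A : {set {set 'I_n}}) (p : {perm 'I_n}) :=
  (p * reverse_perm n (first_initial A p))%g.

(** The search looks at nothing past its first hit, so reversing above that point cannot change its
    outcome. *)
Lemma eq_find_iota (P Q : pred nat) i m :
  (forall k, (k <= i + find P (iota i m))%N -> Q k = P k) ->
  find Q (iota i m) = find P (iota i m).
Proof.
elim: m i => //= m IHm i eqPQ; rewrite eqPQ ?leq_addr //.
case: ifP => // Pi; rewrite IHm // => k le_k; apply: eqPQ.
by rewrite Pi addnS -addSn.
Qed.

Lemma first_initial_reflect n (A : {set {set 'I_n}}) p :
  first_initial A (reflect_above A p) = first_initial A p.
Proof.
by apply: eq_find_iota => k le_ka; rewrite initial_reverse_low.
Qed.

Lemma reflect_aboveK n (A : {set {set 'I_n}}) : involutive (reflect_above A).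
Proof.
move=> p; rewrite {1}/reflect_above first_initial_reflect /reflect_above -mulgA.
apply/permP=> x; rewrite !permM !permE; exact: reverse_aboveK.
Qed.

Lemma chain_count_djoin n (A B : {set {set 'I_n}}) (p : {perm 'I_n}) :
  (chain_count p A + chain_count (p * reverse_perm n 0)%g B <=
     n.+1 + chain_count (reflect_above A p) (djoin A B))%N.
Proof.
rewrite /chain_count /reflect_above; set a := first_initial A p.
set q := (p * reverse_perm n 0)%g; set r := (p * reverse_perm n a)%g.
rewrite -!(big_mkord xpredT (fun k => nat_of_bool (_ k \in _))).
have sum_le p' (F : {set {set 'I_n}}) i j :
    (\sum_(i <= k < j) (initial p' k \in F) <= j - i)%N.
  rewrite -[leqRHS]muln1 -sum_nat_const_nat.
  by apply: leq_sum => k _; case: (_ \in F).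
have A0 k : (k < a)%N -> (k <= n)%N -> (initial p k \in A) = false.
  by move=> lt_ka le_kn; have := before_find 0%N lt_ka; rewrite nth_iota ?add0n.
(* If no initial segment is in [A], the trivial bound [n.+1] on the count for [B] suffices. *)
have [lt_na|le_an] := ltnP n a.
  rewrite [X in (X + _ <= _)%N]big_nat big1 => [|k lt_kn]; last first.
    by rewrite A0 //; lia.
  by rewrite add0n; apply: leq_trans (sum_le _ _ _ _) _; rewrite subn0 leq_addr.
have aA : initial p a \in A.
  have hasA : has (fun k => initial p k \in A) (iota 0 n.+1).
    by rewrite has_find size_iota.
  by have := nth_find 0%N hasA; rewrite nth_iota.
rewrite (@big_cat_nat _ _ _ a) //=; last exact: leqW.
rewrite [X in (X + _ + _ <= _)%N]big_nat big1 => [|k lt_ka]; last first.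
  by rewrite A0 //; lia.
(* Only final segments of size at most [n - a] avoid [initial p a]; the [a] larger sizes are bounded
   trivially. *)
rewrite [X in (_ + X <= _)%N](@big_cat_nat _ _ _ (n.+1 - a)) ?leq_subr //=.
rewrite [in leqRHS](@big_cat_nat _ _ _ a) //=; last exact: leqW.
have -> : (\sum_(a <= k < n.+1) (initial r k \in djoin A B) =
          \sum_(0 <= b < n.+1 - a) (initial r (b + a) \in djoin A B))%N.
  by rewrite -{1}[a]add0n big_addn.
have : (\sum_(0 <= b < n.+1 - a) (initial q b \in B) <=
        \sum_(0 <= b < n.+1 - a) (initial r (b + a) \in djoin A B))%N.
  rewrite !big_nat; apply: leq_sum => b lt_b.
  have le_abn : (a + b <= n)%N by lia.
  case: (boolP (_ \in B)) => // bB; rewrite lt0b addnC initial_reverse_high //.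
  apply/imset2P; exists (initial p a) (initial q b) => //.
  by rewrite inE bB disjoint_initial_final.
rewrite add0n => le_qr.
(* The trivial bounds [n.+1 - a] for [A] and [a] for the large final segments add up to [n.+1]. *)
apply: leq_trans (leq_add (sum_le _ _ _ _) (leq_add le_qr (sum_le _ _ _ _))) _.
rewrite subKn; last exact: leqW.
rewrite addnCA subnK; last exact: leqW.
by rewrite [in leqLHS]addnC leq_add2l leq_addl.
Qed.

Lemma binomial_norm_djoin n (A B : {set {set 'I_n}}) :
  binomial_norm A + binomial_norm B <= n.+1%:R + binomial_norm (djoin A B).
Proof.
have fact_pos : 0 < n`!%:R :> rat by rewrite ltr0n fact_gt0.
rewrite -(ler_pM2r fact_pos) !mulrDl !binomial_norm_chain -natrM -!natrD ler_nat.
(* Both modified chains are bijective images of [p], so the inequality can be summed ordering by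
   ordering. *)
rewrite [X in (_ + X <= _)%N](reindex_inj (mulIg (reverse_perm n 0))) /=.
rewrite [X in (_ <= _ + X)%N](reindex_inj (can_inj (reflect_aboveK A))) /=.
rewrite -card_Sn mulnC -sum_nat_const.
by rewrite -!big_split; apply: leq_sum => p _; exact: chain_count_djoin.
Qed.

(** * Merging all families *)

Lemma djoin_set0 n (A : {set {set 'I_n}}) : djoin A [set set0] = A.
Proof.
apply/setP=> X; apply/imset2P/idP => [[Y Z YA]|XA].
  by rewrite !inE => /andP[/eqP-> _] ->; rewrite setU0.
by exists X set0; rewrite ?setU0 // !inE eqxx -setI_eq0 setI0 eqxx.
Qed.

(** Each merge costs [n.+1], except the innermost one with the neutral family [[set set0]], which is
    free; hence the factor [s] for [s.+1] families. *)
Lemma binomial_norm_bigdjoin n s (F : 'I_s.+1 -> {set {set 'I_n}}) :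
  \sum_i binomial_norm (F i) <=
    n.+1%:R * s%:R + binomial_norm (\big[@djoin n/[set set0]]_i F i).
Proof.
elim: s F => [|s IHs] F.
  by rewrite !big_ord_recl !big_ord0 djoin_set0 mulr0 add0r addr0.
rewrite big_ord_recl [in leRHS]big_ord_recl.
have := IHs (fun i => F (lift ord0 i)).
have := binomial_norm_djoin (F ord0) (\big[@djoin n/[set set0]]_i F (lift ord0 i)).
rewrite -[s.+1%:R]natr1; lra.
Qed.

Lemma mem_bigdjoin n s (F : 'I_s -> {set {set 'I_n}}) X :
  X \in \big[@djoin n/[set set0]]_i F i ->
  exists A : 'I_s -> {set 'I_n},
    [/\ forall i, A i \in F i,
        forall i j, i != j -> [disjoint A i & A j]
      & \bigcup_i A i = X].
Proof.
elim: s F X => [|s IHs] F X.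
  rewrite big_ord0 inE => /eqP->.
  by exists (fun _ => set0); split=> [[]|[]|]; rewrite ?big_ord0.
rewrite big_ord_recl => /imset2P[Y Z YF]; rewrite inE => /andP[/IHs].
move=> [A [AF disjA <-]] disjY ->.
have disjYA i : [disjoint Y & A i].
  by apply: disjointWr disjY; exact: bigcup_sup.
exists (fun i => oapp A Y (unlift ord0 i)); split.
- move=> i; case: (unliftP ord0 i) => [j|] ->; [exact: AF | exact: YF].
- move=> i j; case: (unliftP ord0 i) => [i'|] ->;
    case: (unliftP ord0 j) => [j'|] -> //=.
  + by rewrite (inj_eq lift_inj) => /disjA.
  + by rewrite disjoint_sym.
- rewrite big_ord_recl unlift_none /=; congr (_ :|: _).
  by apply: eq_bigr => i _; rewrite liftK.
Qed.

(** Each chain has [n.+1] segments, and those of sizes 0 to [d] are outside [F]. *)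
Lemma binomial_norm_large n d (F : {set {set 'I_n}}) : (d <= n)%N ->
  (forall X, X \in F -> (d < #|X|)%N) -> binomial_norm F <= n%:R - d%:R.
Proof.
move=> le_dn largeF; have fact_pos : 0 < n`!%:R :> rat by rewrite ltr0n fact_gt0.
rewrite -(ler_pM2r fact_pos) binomial_norm_chain -natrB // -natrM ler_nat.
rewrite -card_Sn mulnC -sum_nat_const; apply: leq_sum => p _.
rewrite /chain_count -(big_mkord xpredT (fun k => nat_of_bool (initial p k \in F))).
rewrite (@big_cat_nat _ _ _ d.+1) //= big_nat big1 => [|k lt_kd].
  rewrite add0n -subSS -[leqRHS]muln1 -sum_nat_const_nat.
  by apply: leq_sum => k _; case: (_ \in F).
by case: (boolP (_ \in F)) => // /largeF; rewrite card_initial; lia.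
Qed.

Theorem theorem2p2 (n d s : nat) (hd : (d <= n)%N) (hs : (1 <= s)%N)
    (F : 'I_s -> {set {set 'I_n}}) (hF : cross_dependent d F) :
  \sum_(i < s) binomial_norm (F i) <= (n%:R + 1) * s%:R - (d%:R + 1).
Proof.
case: s hs F hF => // s _ F hF.
have large X : X \in \big[@djoin n/[set set0]]_i F i -> (d < #|X|)%N.
  move=> /mem_bigdjoin[A [AF disjA <-]]; rewrite ltnNge; apply/negP => le_d.
  by apply: hF; exists A.
have := binomial_norm_bigdjoin F; have := binomial_norm_large hd large.
rewrite -[s.+1%:R]natr1 -[n.+1%:R]natr1; lra.
Qed.
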